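(* Let $\mathcal{P}$ be an $n\times n$ symmetric sign pattern with all diagonal entries equal to $0$ whose underlying graph $G(\mathcal{P})$ is a tree. Then $\mathcal{P}$ requires full $P$-vertices if and only if $G(\mathcal{P})$ has a perfect matching.
   Context: A sign pattern of order $n$ is an $n\times n$ matrix $\mathcal{P}=[p_{ij}]$ with entries in $\{+,-,0\}$; it is symmetric if $p_{ij}=p_{ji}$ for all $i,j$. $\mathcal{Q}_{\mathrm{SYM}}(\mathcal{P})$ is the set of all real symmetric $n\times n$ matrices $A=[a_{ij}]$ with $\mathrm{sgn}(a_{ij})=p_{ij}$ for all $i,j$. The underlying graph $G(\mathcal{P})$ is the undirected graph on vertices $v_1,\dots,v_n$ with an edge $\{v_i,v_j\}$ exactly when $p_{ij}\neq 0$. For a real symmetric matrix $A$, $m_A(0)$ is the algebraic multiplicity of $0$ as an eigenvalue of $A$ (zero if $0$ is not an eigenvalue), and $A(j)$ is the principal submatrix obtained by deleting row and column $j$. The vertex $v_j$ is a $P$-vertex of $A$ if $m_{A(j)}(0)-m_A(0)=1$. The pattern $\mathcal{P}$ of order $n$ requires full $P$-vertices if, for every $A\in\mathcal{Q}_{\mathrm{SYM}}(\mathcal{P})$, all $n$ vertices are $P$-vertices of $A$. *)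

(* Defs.v *)
From mathcomp Require Import all_boot all_order all_algebra.
From mathcomp Require Import reals.

Set Implicit Arguments.
Unset Strict Implicit.
Unset Printing Implicit Defensive.

Import Order.TTheory GRing.Theory Num.Theory.

Local Open Scope ring_scope.

Section Graphs.
Variables (T : finType) (e : rel T).

Definition simple_graph := symmetric e /\ irreflexive e.

Definition connected_graph := (0 < #|T|)%N /\ (forall x y, connect e x y).

(* The condition [2 < size c] is needed because the sequence x, y is a
   duplicate-free cycle of the relation [e] as soon as x and y are adjacent. *)
Definition acyclic_graph := forall c : seq T, (2 < size c)%N -> ~ ucycle e c.

Definition is_tree := [/\ simple_graph, connected_graph & acyclic_graph].

Definition edges : {set {set T}} := [set [set x; y] | x in T, y in e x].

Definition perfect_matching (M : {set {set T}}) :=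
  (M \subset edges) && partition M [set: T].

Definition has_perfect_matching := exists M, perfect_matching M.

End Graphs.

Section SignPatterns.
Variable n : nat.

(* The signs +, - and 0 are encoded by the integers 1, -1 and 0, which are the
   values of [sgz]. *)
Definition sign_pattern (P : 'M[int]_n) :=
  forall i j, P i j \in [:: 1; -1; 0].

Definition pattern_graph (P : 'M[int]_n) : rel 'I_n :=
  [rel i j | P i j != 0].

Definition Q_SYM (R : realType) (P : 'M[int]_n) (A : 'M[R]_n) :=
  A^T = A /\ (forall i j, sgz (A i j) = P i j).

End SignPatterns.

Definition alg_mult (R : realType) n (A : 'M[R]_n) (a : R) : nat :=
  mup a (char_poly A).

Definition principal_del (R : realType) n (A : 'M[R]_n) (j : 'I_n) :
    'M[R]_n.-1 :=
  row' j (col' j A).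

Definition P_vertex (R : realType) n (A : 'M[R]_n) (j : 'I_n) :=
  (alg_mult (principal_del A j) 0)%:Z - (alg_mult A 0)%:Z = 1.

Definition requires_full_P_vertices (R : realType) n (P : 'M[int]_n) :=
  forall A : 'M[R]_n, Q_SYM P A -> forall j : 'I_n, P_vertex A j.

(* Main.v *)
(** In an acyclic graph, a permutation moving every vertex along an edge is an
    involution, i.e. a perfect matching, and there is at most one: otherwise
    some nonempty set of vertices would induce a subgraph of minimum degree 2.
    Hence a matrix [A] with zero diagonal whose graph is a forest is
    nonsingular iff the forest has a perfect matching.

    If all vertices are P-vertices, then [A] is nonsingular, because the
    derivative of its characteristic polynomial is the sum of those of the
    [A(j)]. Conversely, a perfect matching makes [A] nonsingular and its order
    even, so that each [A(j)], of odd order, is singular; and [0] is a simple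
    root of its characteristic polynomial, as is seen by expanding
    [('X - A)^-1] at [0] to first order. *)
Require Import Defs.
From mathcomp Require Import all_boot all_order fingroup perm all_algebra.
From mathcomp Require Import reals.
Import GRing.Theory.
Local Open Scope ring_scope.

(** * Matchings and involutions in acyclic graphs *)

Section AcyclicGraphs.
Variables (T : finType) (e : rel T).

(* The head of a path in [S] can always be extended by whichever of its two
   neighbours is not its successor, unless this closes a cycle. *)
Lemma acyclic_no_degree2_closed (S : pred T) (f g : T -> T) :
  simple_graph e -> acyclic_graph e ->
  (forall x, S x -> [/\ e x (f x), e x (g x), f x != g x, S (f x) & S (g x)]) ->
  forall x, ~~ S x.
Proof.
move=> [e_sym e_irr] e_acyc fgS x; apply/negP => Sx.
(* Growing the path at its head [y] up to [#|T|] + 2 distinct vertices contradicts finiteness. *)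
have [p [y [z]]] : exists p y z, [/\ size p = #|T|, path e y (z :: p),
    uniq (y :: z :: p) & all S (y :: z :: p)].
  elim: #|T| => [|k [p [y [z [sz_p e_p uniq_p S_p]]]]].
    have [exf _ _ Sf _] := fgS x Sx; exists [::], x, (f x).
    split=> //=; rewrite ?exf ?Sx ?Sf ?inE ?andbT //.
    by apply: contraTneq exf => <-; rewrite e_irr.
  have Sy : S y by case/andP: S_p.
  have [w [eyw Sw wz]] : exists w, [/\ e y w, S w & w != z].
    have [ef eg fg Sf Sg] := fgS y Sy.
    have [fz|fz] := eqVneq (f y) z; last by exists (f y).
    by exists (g y); rewrite -fz eq_sym.
  exists (z :: p), w, y; split=> [|||/=]; first by rewrite /= sz_p.
  - by rewrite /= e_sym eyw.
  - rewrite cons_uniq uniq_p andbT inE negb_or.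
    have wy : w != y by apply: contraTneq eyw => ->; rewrite e_irr.
    rewrite wy /= inE negb_or wz /=; apply/negP => w_p.
    (* If [w] is already on the path, the stretch from [y] to [w] closes into a cycle; it has length
       at least 3 since [w] is neither [y] nor [z]. *)
    case/splitPr: w_p e_p uniq_p {sz_p S_p} => p1 p2 e_p uniq_p.
    case: (e_acyc [:: y, z & rcons p1 w]) => //=; first by rewrite size_rcons.
    move: e_p uniq_p; rewrite -cat_rcons -!cat_cons cat_path cat_uniq.
    case/andP=> e_p _ /and3P[uniq_p _ _].
    rewrite /ucycle uniq_p andbT -[path.cycle _ _]/(path e y (rcons (_ :: _) y)).
    by rewrite rcons_path e_p /= last_rcons e_sym.
  - by rewrite Sw.
move=> [sz_p _ uniq_p _]; have := max_card (mem (y :: z :: p)).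
by rewrite (card_uniqP uniq_p) /= sz_p ltnNge leqnSn.
Qed.

(** The points with [s (s x) != x] are stable under [s] and its inverse, which give each of them two
    distinct neighbours. *)
Lemma acyclic_perm_involutive (s : {perm T}) :
  simple_graph e -> acyclic_graph e -> (forall x, e x (s x)) -> involutive s.
Proof.
move=> e_simple e_acyc es x; apply/eqP/negPn.
apply: (acyclic_no_degree2_closed (fun x => s (s x) != x) s (s^-1)%g) => //.
move=> {}x ssx.
have s'x : s (s^-1%g x) = x by rewrite permKV.
split=> //.
- by rewrite (proj1 e_simple) -{2}s'x.
- by apply: contra_neq ssx => ->.
- by apply: contra_neq ssx => /perm_inj.
- by rewrite s'x; apply: contra_neq ssx => ->.
Qed.

Lemma acyclic_involution_uniq (s t : T -> T) :
  simple_graph e -> acyclic_graph e -> involutive s -> involutive t ->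
  (forall x, e x (s x)) -> (forall x, e x (t x)) -> s =1 t.
Proof.
move=> e_simple e_acyc sK tK es et x; apply/eqP/negPn.
apply: (acyclic_no_degree2_closed (fun x => s x != t x) s t) => // {}x stx.
split=> //.
- by rewrite sK; apply: contra_neq stx => {2}->; rewrite tK.
- by rewrite tK; apply: contra_neq stx => {1}<-; rewrite sK.
Qed.

Lemma perfect_matching_involution :
  simple_graph e -> has_perfect_matching e ->
  exists2 s : T -> T, involutive s & forall x, e x (s x).
Proof.
move=> [e_sym e_irr] [M /andP[/subsetP M_edges M_part]].
have [cover_M triv_M _] := and3P M_part.
have pM x : x \in pblock M x by rewrite mem_pblock (eqP cover_M) inE.
have exM x : exists y, (pblock M x == [set x; y]) && e x y.
  have /M_edges /imset2P[a b _] : pblock M x \in M.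
    by rewrite pblock_mem // (eqP cover_M) inE.
  rewrite unfold_in => eab Mx; have := pM x; rewrite Mx !inE.
  case/orP=> /eqP->; first by exists b; rewrite eqxx.
  by exists a; rewrite setUC eqxx e_sym.
have sM x := andP (xchooseP (exM x)).
exists (fun x => xchoose (exM x)) => x; last by case: (sM x).
set y := xchoose (exM x); have [/eqP Mx exy] := sM x.
have Myx : pblock M y = pblock M x.
  by apply: (same_pblock triv_M); rewrite Mx !inE eqxx orbT.
have [/eqP My _] := sM y.
have : x \in [set y; xchoose (exM y)] by rewrite -My Myx pM.
rewrite !inE => /orP[/eqP xy|/eqP //].
by move: exy; rewrite -/y -xy e_irr.
Qed.

Lemma involution_perfect_matching (s : T -> T) :
  involutive s -> (forall x, e x (s x)) -> has_perfect_matching e.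
Proof.
move=> sK es; exists [set [set x; s x] | x in T]; apply/and3P; split.
- apply/subsetP => _ /imsetP[x _ ->]; apply/imset2P.
  by exists x (s x) => //; rewrite unfold_in.
- apply/eqP/setP => x; rewrite inE; apply/bigcupP.
  by exists [set x; s x]; [exact: imset_f | rewrite !inE eqxx].
- apply/andP; split; last first.
    by apply/imsetP => -[x _ /setP/(_ x)]; rewrite !inE eqxx.
  apply/trivIsetP => _ _ /imsetP[x _ ->] /imsetP[y _ ->].
  apply: contraR => /pred0Pn[z /=]; rewrite !inE.
  (* A block is determined by any of its elements [z], so blocks that meet coincide. *)
  have sE x' : (z == x') || (z == s x') -> [set x'; s x'] = [set z; s z].
    by case/orP=> /eqP->; rewrite ?sK // setUC.
  by case/andP=> /sE-> /sE->.
Qed.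

Lemma perfect_matching_card_even :
  irreflexive e -> has_perfect_matching e -> ~~ odd #|T|.
Proof.
move=> e_irr [M /andP[/subsetP M_edges M_part]].
rewrite -cardsT (card_uniform_partition _ M_part (n := 2)) ?muln2 ?odd_double //.
move=> _ /M_edges /imset2P[x y _ + ->]; rewrite unfold_in cards2 => exy.
by case: eqP exy => // ->; rewrite e_irr.
Qed.

(** Serves for deleting a vertex, with [f] a [lift]. Connectedness may be lost, hence lemmas on
    acyclic graphs rather than trees. *)
Lemma acyclic_graph_relpre (T' : finType) (f : T' -> T) :
  injective f -> acyclic_graph e -> acyclic_graph (relpre f e).
Proof.
move=> f_inj e_acyc c c_gt2 /andP[c_cyc c_uniq].
apply: (e_acyc (map f c)); first by rewrite size_map.
by rewrite /ucycle cycle_map map_inj_uniq // c_cyc.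
Qed.

Lemma simple_graph_relpre (T' : finType) (f : T' -> T) :
  simple_graph e -> simple_graph (relpre f e).
Proof. by move=> [e_sym e_irr]; split=> [x y|x] /=. Qed.

End AcyclicGraphs.

(** * Nonsingularity and perfect matchings *)

Lemma det_neq0_perm (F : fieldType) n (A : 'M[F]_n) :
  \det A != 0 -> exists s : 'S_n, forall i, A i (s i) != 0.
Proof.
move=> detA.
have /existsP[s /forallP As] :
    [exists s : 'S_n, [forall i, A i (s i) != 0]].
  apply: contraNT detA; rewrite negb_exists => /forallP As.
  apply/eqP/big1 => s _; apply/eqP; rewrite mulf_eq0 orbC.
  have /forallPn[i Ai] := As s.
  by apply/orP; left; apply/prodf_eq0; exists i => //; apply/negPn.
by exists s.
Qed.

Lemma acyclic_det_neq0_matching (F : fieldType) n (e : rel 'I_n) (A : 'M[F]_n) :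
  simple_graph e -> acyclic_graph e -> (forall i j, A i j != 0 -> e i j) ->
  \det A != 0 -> has_perfect_matching e.
Proof.
move=> e_simple e_acyc Ae /det_neq0_perm[s As].
have es i : e i (s i) by exact: Ae.
apply: (involution_perfect_matching _ _ s) => //.
exact: (acyclic_perm_involutive _ e).
Qed.

(** By uniqueness of the matching, exactly one term of the Leibniz formula is nonzero, so nothing
    cancels. *)
Lemma acyclic_matching_det_neq0 (F : fieldType) n (e : rel 'I_n) (A : 'M[F]_n) :
  simple_graph e -> acyclic_graph e -> (forall i j, (A i j != 0) = e i j) ->
  has_perfect_matching e -> \det A != 0.
Proof.
move=> e_simple e_acyc Ae /(perfect_matching_involution _ _ e_simple)[s sK es].
pose s1 := perm (inv_inj sK).
rewrite /determinant (bigD1 s1) //= [X in _ + X]big1 ?addr0 => [|t ts].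
  rewrite mulf_neq0 ?signr_eq0 //; apply/prodf_neq0 => i _.
  by rewrite permE Ae.
have [i Ai] : exists i, A i (t i) == 0.
  apply/existsP; apply: contraNT ts => /existsPn Ai.
  have et i : e i (t i) by rewrite -Ae.
  apply/eqP/permP => i; rewrite permE.
  apply: (acyclic_involution_uniq _ e) => //.
  exact: (acyclic_perm_involutive _ e).
by rewrite (bigD1 i) //= (eqP Ai) mul0r mulr0.
Qed.

(** * Derivative of the characteristic polynomial *)

Lemma deriv_prod (R : comNzRingType) (I : finType) (F : I -> {poly R}) :
  (\prod_i F i)^`() = \sum_i \prod_j (if j == i then (F j)^`() else F j).
Proof.
have deriv_prodr (r : seq I) : uniq r ->
    (\prod_(i <- r) F i)^`() =
    \sum_(i <- r) \prod_(j <- r) (if j == i then (F j)^`() else F j).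
  elim: r => [|i r IHr] /=; first by rewrite !big_nil derivC.
  case/andP=> ir /IHr{}IHr; rewrite !big_cons derivM IHr eqxx mulr_sumr.
  congr (_ * _ + _).
    by apply: eq_big_seq => j jr; case: eqP jr ir => // -> ->.
  apply: eq_big_seq => j jr; rewrite big_cons.
  by case: eqP jr ir => // -> ->.
by apply: deriv_prodr; exact: index_enum_uniq.
Qed.

(** Differentiating one row at a time gives the matrices [N i]; expanding [N i] along row [i] only
    meets cofactors of [A]. *)
Lemma deriv_det (R : comNzRingType) n (A : 'M[{poly R}]_n) :
  (\det A)^`() = \sum_i \sum_j (A i j)^`() * cofactor A i j.
Proof.
pose N i : 'M_n := \matrix_(k, j) if k == i then (A k j)^`() else A k j.
transitivity (\sum_i \det (N i)).
  rewrite raddf_sum exchange_big; apply: eq_bigr => s _ /=.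
  have sgn_poly : (-1) ^+ s = ((-1) ^+ s)%:P :> {poly R}.
    by rewrite rmorph_sign.
  rewrite sgn_poly deriv_mulC deriv_prod -mulr_sumr.
  by congr (_ * _); apply: eq_bigr => i _; apply: eq_bigr => j _; rewrite mxE.
apply: eq_bigr => i _; rewrite (expand_det_row _ i); apply: eq_bigr => j _.
rewrite mxE eqxx /cofactor; congr (_ * (_ * \det _)).
by apply/matrixP => k l; rewrite !mxE eq_sym (negbTE (neq_lift _ _)).
Qed.

Lemma deriv_char_poly (R : realType) n (A : 'M[R]_n) :
  (char_poly A)^`() = \sum_i char_poly (principal_del A i).
Proof.
rewrite /char_poly deriv_det; apply: eq_bigr => i _.
rewrite (bigD1 i) //= big1 ?addr0 => [|j ji].
  rewrite !mxE eqxx mulr1n derivB derivX derivC subr0 mul1r.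
  by rewrite /cofactor -signr_odd oddD addbb mul1r row'_col'_char_poly_mx.
by rewrite !mxE eq_sym (negbTE ji) mulr0n sub0r derivN derivC oppr0 mul0r.
Qed.

(** * Multiplicity of the eigenvalue 0 *)

Lemma mup0_geq (F : fieldType) (p : {poly F}) k :
  p != 0 -> reflect (forall i, (i < k)%N -> p`_i = 0) (k <= mup 0 p)%N.
Proof.
move=> p0; rewrite mup_geq // subr0; apply: (iffP idP) => [/dvdpP[q ->] i ik|pk].
  by rewrite coefMXn ik.
suff -> : p = drop_poly k p * 'X^k by exact: dvdp_mulIr.
rewrite -[LHS](poly_take_drop k) -[RHS]add0r; congr (_ + _).
by apply/polyP => i; rewrite coef_take_poly coef0; case: ifP => // /pk.
Qed.

Lemma char_poly_neq0 (F : fieldType) n (A : 'M[F]_n) : char_poly A != 0.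
Proof. exact/monic_neq0/char_poly_monic. Qed.

Lemma alg_mult0_gt0 (R : realType) n (A : 'M[R]_n) :
  (0 < alg_mult A 0)%N = (\det A == 0).
Proof.
apply/(mup0_geq _ _ _ (char_poly_neq0 _ _ _))/eqP => [/(_ 0%N isT)|detA [] // _];
  rewrite char_poly_det; last by rewrite detA mulr0.
by move/eqP; rewrite mulf_eq0 signr_eq0 => /eqP.
Qed.

(* If [0] has multiplicity [m > 0], it has multiplicity exactly [m - 1] in
   the derivative of [char_poly A], which is the sum of the [char_poly]'s of
   the principal submatrices: these cannot all be divisible by ['X^(m + 1)]. *)
Lemma full_P_vertices_det_neq0 (R : realType) n (A : 'M[R]_n) :
  (forall j, P_vertex A j) -> \det A != 0.
Proof.
move=> fullA; rewrite -alg_mult0_gt0 -leqNgt.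
case mE: (alg_mult A 0) => [//|m].
have mA j : (m < alg_mult (principal_del A j) 0)%N.
  by have := fullA j; rewrite /P_vertex mE => /eqP; rewrite subr_eq => /eqP[->].
suff : (m.+2 <= alg_mult A 0)%N by rewrite mE ltnn.
apply/(mup0_geq _ _ _ (char_poly_neq0 _ _ _)) => i.
(* Only the coefficient of degree [m.+1] is new; [m.+1] times it is the coefficient of degree [m] of
   the derivative, and the characteristic is 0. *)
rewrite ltnS leq_eqVlt => /predU1P[->|im]; last first.
  have : (m < alg_mult A 0)%N by rewrite mE.
  by move/(mup0_geq _ _ _ (char_poly_neq0 _ _ _)) ->.
have : (char_poly A)^`()`_m = 0.
  rewrite deriv_char_poly coef_sum big1 // => j _.
  by have /(mup0_geq _ _ _ (char_poly_neq0 _ _ _)) -> := mA j.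
by rewrite coef_deriv => /eqP; rewrite Num.Theory.mulrn_eq0 => /eqP.
Qed.

(* Modulo ['X^2], the inverse of ['X - A] is [- (C + 'X C^2)] with
   [C = A^-1]; the [j]-th diagonal entry of [C^2] is the squared norm of the
   [j]-th column of [C]. *)
Lemma symmetric_unit_alg_mult_del (R : realType) n (A : 'M[R]_n) j :
  A^T = A -> \det A != 0 -> (alg_mult (principal_del A j) 0 <= 1)%N.
Proof.
move=> symA detA; set B := principal_del A j.
have Au : A \in unitmx by rewrite unitmxE unitfE.
pose C := invmx A; pose D := C *m C.
have Djj : D j j != 0.
  have CT : C^T = C by rewrite trmx_inv symA.
  have DE : D j j = \sum_k C k j ^+ 2.
    by rewrite mxE; apply: eq_bigr => k _; rewrite -{1}CT mxE expr2.
  rewrite DE Num.Theory.psumr_neq0 => [|k _]; last exact: Num.Theory.sqr_ge0.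
  apply/hasP; have /existsP[k Ck] : [exists k, C k j != 0].
    apply/existsPn => C0; have := mulmxV Au => /matrixP/(_ j j).
    rewrite !mxE eqxx big1 => [/eqP|k _]; first by rewrite eq_sym oner_eq0.
    by have /negPn/eqP -> := C0 k; rewrite mulr0.
  by exists k; rewrite ?mem_index_enum //= Num.Theory.exprn_even_gt0.
pose Cp := map_mx polyC C; pose Ap := map_mx polyC A.
have ApCp : Ap *m Cp = 1%:M by rewrite -map_mxM mulmxV // map_mx1.
have inv_mod : char_poly_mx A *m (Cp + 'X *: (Cp *m Cp))
    = 'X^2 *: (Cp *m Cp) - 1%:M.
  have -> : char_poly_mx A = 'X%:M - Ap by [].
  have ApE : Ap *m (Cp + 'X *: (Cp *m Cp)) = 'X *: Cp + 1%:M.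
    by rewrite mulmxDr -scalemxAr mulmxA ApCp mul1mx addrC.
  rewrite mulmxBl {}ApE mul_scalar_mx scalerDr scalerA -expr2.
  by rewrite opprD addrACA subrr add0r.
have cofE : cofactor (char_poly_mx A) j j = char_poly B.
  by rewrite /cofactor -signr_odd oddD addbb mul1r row'_col'_char_poly_mx.
have /matrixP/(_ j j) : char_poly A *: (Cp + 'X *: (Cp *m Cp)) =
    'X^2 *: (\adj (char_poly_mx A) *m (Cp *m Cp)) - \adj (char_poly_mx A).
  by rewrite -mul_scalar_mx -mul_adj_mx -mulmxA inv_mod mulmxBr mulmx1 -scalemxAr.
rewrite -map_mxM -/D; clearbody D; rewrite !mxE cofE.
set q := \sum_k _ => BE.
(* If the coefficients of degrees 0 and 1 of [char_poly B] vanish, comparing constant terms in [BE]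
   gives [C j j = 0], and then the terms of degree 1 give [D j j = 0]. *)
rewrite leqNgt; apply/negP => /(mup0_geq _ _ _ (char_poly_neq0 _ _ _)) B0.
have A0 : (char_poly A)`_0 != 0.
  by rewrite char_poly_det mulf_neq0 ?signr_eq0.
have Cjj : C j j = 0.
  have /eqP := congr1 (coefp 0%N) BE.
  rewrite /= coef0M coefD coefC coefXM coefB coefXnM B0 //= !subr0 addr0.
  by rewrite mulf_eq0 (negbTE A0) => /eqP.
have /eqP := congr1 (coefp 1%N) BE.
rewrite Cjj add0r mulrCA /= coefXM coefB coefXnM B0 //= subr0 coefMC.
by rewrite mulf_eq0 (negbTE A0) (negbTE Djj).
Qed.

Theorem theorem2p1 (R : realType) (n : nat) (P : 'M[int]_n)
    (signP : sign_pattern P) (symP : P^T = P)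
    (diagP : forall i : 'I_n, P i i = 0)
    (treeP : is_tree (pattern_graph P)) :
  requires_full_P_vertices R P <-> has_perfect_matching (pattern_graph P).
Proof.
have [e_simple _ e_acyc] := treeP.
split=> [fullP|matchP A [symA sgnA] j].
  (* A single realization suffices: the signs themselves, read as reals. *)
  pose A : 'M[R]_n := map_mx intr P.
  have QA : Q_SYM P A.
    split=> [|i k]; first by rewrite map_trmx symP.
    have := signP i k; rewrite !inE mxE.
    case/or3P=> /eqP->; first by rewrite mulr1z sgz1.
      by rewrite mulrN1z sgzN1.
    by rewrite mulr0z sgz0.
  apply: (acyclic_det_neq0_matching _ _ _ A) => // [i k|].
    by rewrite mxE intr_eq0.
  by apply: full_P_vertices_det_neq0 => j; exact: fullP.
have Ae i k : (A i k != 0) = pattern_graph P i k.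
  by rewrite /pattern_graph /= -sgnA sgz_eq0.
have detA : \det A != 0 by exact: acyclic_matching_det_neq0 matchP.
have mA : alg_mult A 0 = 0%N.
  by apply/eqP; rewrite -leqn0 leqNgt alg_mult0_gt0.
suff mB : alg_mult (principal_del A j) 0 = 1%N by rewrite /P_vertex mB mA.
apply/eqP; rewrite eqn_leq symmetric_unit_alg_mult_del // alg_mult0_gt0.
apply: contraT => detB.
(* A nonsingular [A(j)] would match the remaining vertices, making both [n] and [n.-1] even. *)
have even_n1 : ~~ odd n.-1.
  rewrite -[n.-1]card_ord.
  apply: (perfect_matching_card_even _ (relpre (lift j) (pattern_graph P))).
    by move=> i; exact: (proj2 e_simple).
  apply: acyclic_det_neq0_matching detB.
  - exact: simple_graph_relpre.
  - by apply: acyclic_graph_relpre e_acyc; exact: lift_inj.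
  - by move=> i k; rewrite !mxE Ae.
have := perfect_matching_card_even _ _ (proj2 e_simple) matchP.
by rewrite card_ord -(ltn_predK (ltn_ord j)) /= (negbTE even_n1).
Qed.
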